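(* Let $\lambda,c,L>0$, let $\Gamma=\{(x,y)\in\mathbb{R}^2:\ 0\le y\le L\}$, let $(X(t),Y(t))$ be the planar random motion with orthogonal directions $d_0,d_1,d_2,d_3$, velocity $c$ and switching rate $\lambda$, and let $\tau=\inf\{t>0:\ (X(t),Y(t))\notin\Gamma\}$. For $(x,y)\in\Gamma$ and $j=0,1,2,3$ put $$p_j(x,y)=\mathbb{P}\big(Y(\tau)=0\,\big|\,X(0)=x,\ Y(0)=y,\ D(0)=d_j\big),\qquad p(x,y)=\mathbb{P}\big(Y(\tau)=0\,\big|\,X(0)=x,\ Y(0)=y\big).$$ Then for all $(x,y)\in\Gamma$, $$p_1(x,y)=\frac{\lambda(L-y)}{\lambda L+2c},\qquad p_3(x,y)=\frac{2c+\lambda(L-y)}{\lambda L+2c},$$ and $$p(x,y)=p_0(x,y)=p_2(x,y)=\frac{c+\lambda(L-y)}{\lambda L+2c}.$$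
   Context: Planar motion with orthogonal directions: the admissible directions are $d_j=(\cos(\pi j/2),\sin(\pi j/2))$, $j=0,1,2,3$ (indices modulo 4). At time $0$ the particle is at $(x,y)$ and picks one of the four directions with probability $\frac14$ each. It moves with constant speed $c>0$; at each event of a homogeneous Poisson process with intensity $\lambda>0$, independent of the initial direction, it turns from the current direction $d_j$ to $d_{j-1}$ or to $d_{j+1}$, each with probability $\frac12$, independently of everything else. $D(t)$ is the direction at time $t$. If the particle starts at $y=L$ with direction $d_1$ (up), or at $y=0$ with direction $d_3$ (down), then $\tau=0$ and it exits immediately through its starting point. *)

(* Defs.v *)
(* MathComp-Analysis *)
From HB Require Import structures.
From mathcomp Require Import all_boot all_order all_algebra finmap.
From mathcomp Require Import all_classical all_reals all_analysis.

Set Implicit Arguments.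
Unset Strict Implicit.
Unset Printing Implicit Defensive.

Import Order.TTheory GRing.Theory Num.Theory.
Import numFieldNormedType.Exports.

Local Open Scope classical_set_scope.
Local Open Scope ring_scope.

Definition mutually_independent {d : measure_display} {T : measurableType d}
    {R : realType} (P : probability T R) (I : choiceType)
    (F : I -> set_system T) : Prop :=
  forall (J : {fset I}%fset) (E : I -> set T),
    (forall i, i \in J -> F i (E i)) ->
    P (\bigcap_(i in [set` J]) E i) = (\prod_(i <- J) P (E i))%E.

Definition sigma_of {T U : Type} (G : set_system U) (f : T -> U) :
    set_system T :=
  preimage_set_system setT f G.

Definition cprob {d : measure_display} {T : measurableType d} {R : realType}
    (P : probability T R) (A B : set T) : R :=
  fine (P (A `&` B)) / fine (P B).

(* N is the homogeneous Poisson process of intensity lambda with interarrival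
   times S: the (n+1)-st event occurs at time S 0 + ... + S n. Since N t is
   natural-valued, the last field includes that only finitely many events
   occur in bounded time. *)
Record poisson_process {d : measure_display} {T : measurableType d}
    {R : realType} (P : probability T R) (lambda : R)
    (S : nat -> {RV P >-> R}) (N : R -> T -> nat) : Prop := PoissonProcess {
  interarrival_gt0 : forall n w, 0 < S n w;
  interarrival_law : forall n (A : set R), measurable A ->
    distribution P (S n) A = exponential_prob lambda A;
  interarrival_indep :
    mutually_independent P (fun n => sigma_of measurable (S n));
  counting_arrivals : forall (t : R) w n, 0 <= t ->
    (n <= N t w)%N = (\sum_(k < n) S k w <= t)
}.

(* Directions are indexed by integers modulo 4. *)
Definition dir (R : realType) (j : 'Z_4) : R * R :=
  (cos (pi * (nat_of_ord j)%:R / 2), sin (pi * (nat_of_ord j)%:R / 2)).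

(* The initial direction, the interarrival times and the turns. *)
Definition noise_sigma {d : measure_display} {T : measurableType d}
    {R : realType} (P : probability T R) (D0 : T -> 'Z_4)
    (S : nat -> {RV P >-> R}) (turn : nat -> {RV P >-> bool})
    (i : option (nat + nat)) : set_system T :=
  match i with
  | None => sigma_of [set: set 'Z_4] D0
  | Some (inl n) => sigma_of measurable (S n)
  | Some (inr n) => sigma_of measurable (turn n)
  end.

(* (X, Y) is the motion with orthogonal directions started at (x, y) and D is
   its direction process. At its (k+1)-st event the direction d_j changes to
   d_(j-1) if turn k holds and to d_(j+1) otherwise. *)
Definition orthogonal_motion {d : measure_display} {T : measurableType d}
    {R : realType} (P : probability T R) (lambda c x y : R)
    (X Y : R -> T -> R) (D : R -> T -> 'Z_4) : Prop :=
  exists (S : nat -> {RV P >-> R}) (N : R -> T -> nat)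
    (turn : nat -> {RV P >-> bool}),
  [/\ poisson_process lambda S N,
      forall k, distribution P (turn k) =1 bernoulli_prob 2^-1,
      forall j, measurable [set w | D 0 w = j] /\
                P [set w | D 0 w = j] = (4^-1)%:E,
      mutually_independent P (noise_sigma (D 0) S turn) &
      forall (t : R) w, 0 <= t ->
        [/\ D t w = D 0 w + \sum_(k < N t w) (-1) ^+ (turn k w),
            X t w = x + c * \int[lebesgue_measure]_(s in `[0, t])
                              (dir R (D s w)).1 &
            Y t w = y + c * \int[lebesgue_measure]_(s in `[0, t])
                              (dir R (D s w)).2]].

Definition strip (R : realType) (L : R) : set (R * R) :=
  [set z | 0 <= z.2 <= L].

Definition exit_time {T : Type} {R : realType} (G : set (R * R))
    (X Y : R -> T -> R) (w : T) : \bar R :=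
  ereal_inf [set t%:E | t in [set t : R | 0 < t /\ ~ G (X t w, Y t w)]].

(* The event Y(tau) = 0, which includes that tau is finite. *)
Definition exit_at_bottom {T : Type} {R : realType} (L : R)
    (X Y : R -> T -> R) : set T :=
  [set w | exists2 t : R, exit_time (strip L) X Y w = t%:E & Y t w = 0].

Definition p_exit {d : measure_display} {T : measurableType d}
    {R : realType} (P : probability T R) (L x y : R)
    (X Y : R -> T -> R) : R :=
  cprob P (exit_at_bottom L X Y) [set w | X 0 w = x /\ Y 0 w = y].

Definition p_exit_dir {d : measure_display} {T : measurableType d}
    {R : realType} (P : probability T R) (L x y : R)
    (X Y : R -> T -> R) (D : R -> T -> 'Z_4) (j : 'Z_4) : R :=
  cprob P (exit_at_bottom L X Y)
    [set w | [/\ X 0 w = x, Y 0 w = y & D 0 w = j]].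

(* Main.v *)
Require Import Defs.
From HB Require Import structures.
From mathcomp Require Import all_boot all_order all_algebra finmap.
From mathcomp Require Import all_classical all_reals all_analysis.
From mathcomp Require Import measurable_realfun ring lra.

Set Implicit Arguments.
Unset Strict Implicit.
Unset Printing Implicit Defensive.

Import Order.TTheory GRing.Theory Num.Theory.
Import numFieldNormedType.Exports.

Local Open Scope classical_set_scope.
Local Open Scope ring_scope.

(** Only the vertical coordinate matters, and only at the turning instants: the
    path is polygonal, so it leaves the strip through the bottom exactly when,
    for some n, its first n + 1 vertices lie in the strip and the next one is
    negative ([exit_at_bottom_vertex], [exit_at_bottom_falls]).

    Let h be the height at a turning instant and v the vertical speed (0, c or
    - c) of the flight that starts there, and consider the affine potential
      phi = lambda (L - h) + c - v.
    It is an exact martingale of the embedded chain in which an exit through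
    the bottom pays lambda L + 2 c and an exit through the top pays 0.  There
    are two reasons for that.
    - Flights are exponential of rate lambda, hence memoryless: stopping a
      flight at the boundary and replacing its overshoot by the mean overshoot
      1 / lambda does not change its mean length 1 / lambda
      ([expectation_memoryless_length]).  So a flight moves lambda (L - h) by
      - v on average, which is exactly the term - v of phi, and a flight that
      crosses the bottom counts as ending at height - c / lambda, one that
      crosses the top as ending at L + c / lambda ([expectation_flight_value]).
    - Both turns are equally likely and opposite, so the new speed has mean 0
      ([expectation_turn]).
    Averaging over a new flight or turn while the past is kept fixed is
    Tonelli's theorem for the product law of the two ([independent_freezing]);
    the independence of the new noise from everything that is measurable with
    respect to the past comes from uniqueness of measures on a pi-system
    ([mutually_independent_past]).

    Summing the one-step identity [potential_step] up to time n,
      E phi_0 = E (phi_n; still inside) + (lambda L + 2 c) P (bottom exit by n).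
    Every vertical flight longer than L / c leaves the strip and at least one of
    two consecutive flights is vertical, so the probability of being still
    inside tends to 0 ([cvg_alive]).  As phi is bounded in the strip, the bottom
    exit probability is E phi_0 / (lambda L + 2 c) ([falls_potential]), which
    for an initial direction with vertical component e is
      (lambda (L - y) + c - c e) / (lambda L + 2 c),
    and averaging over the four directions gives the unconditional value. *)

(** * Independence of the past and conditioning on it *)

(** A pi-system that generates the sigma-algebra of the families with index
    in Q. *)
Definition cylinders {T : Type} {I : choiceType} (F : I -> set_system T)
    (Q : set I) : set_system T :=
  [set B | exists (J : {fset I}%fset) (E : I -> set T),
    (forall i, i \in J -> Q i /\ F i (E i)) /\
    B = \bigcap_(i in [set` J]) E i].

(** Two cylinders need not have the same finite index set; each is extended by
    the sure event to the union of both. *)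
Lemma cylinders_setI {T : Type} {I : choiceType} (F : I -> set_system T)
    (Q : set I) :
  (forall i, F i setT) -> (forall i, setI_closed (F i)) ->
  setI_closed (cylinders F Q).
Proof.
move=> FT FI _ _ [J1 [E1 [E1F ->]]] [J2 [E2 [E2F ->]]].
pose ext (J : {fset I}%fset) (E : I -> set T) i :=
  if i \in J then E i else setT.
have extF J E i : (forall i, i \in J -> Q i /\ F i (E i)) -> F i (ext J E i).
  by rewrite /ext => EF; case: ifP => // /EF[].
exists (J1 `|` J2)%fset, (fun i => ext J1 E1 i `&` ext J2 E2 i); split.
  move=> i; rewrite in_fsetU => Ji; split; last by apply: FI; exact: extF.
  by case/orP: Ji => [/E1F|/E2F] [].
apply/seteqP; split=> w.
  move=> [w1 w2] i _; rewrite /ext.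
  by split; case: ifP => // ?; [exact: w1|exact: w2].
move=> Hw; split=> i /= iJ.
  by have [] := Hw i; rewrite /= ?in_fsetU /ext iJ.
by have [] := Hw i; rewrite /= ?in_fsetU /ext iJ ?orbT.
Qed.

Lemma cylinders_gen {T : Type} {I : choiceType} (F : I -> set_system T)
    (Q : set I) i A : Q i -> F i A -> <<s cylinders F Q >> A.
Proof.
move=> Qi FA; apply: sub_sigma_algebra.
exists [fset i]%fset, (fun=> A); split.
  by move=> j; rewrite inE => /eqP->.
by rewrite set_fset1 bigcap_set1.
Qed.

(** For a fixed B, the maps A |-> P (A and B) and A |-> P A * P B are finite
    measures.  They agree on cylinders by mutual independence, hence on the
    generated sigma-algebra. *)
Lemma mutually_independent_past {d : measure_display} {T : measurableType d}
    {R : realType} (P : probability T R) (I : choiceType)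
    (F : I -> set_system T) (Q : set I) (i0 : I) (A B : set T) :
  mutually_independent P F -> (forall i, F i setT) ->
  (forall i, setI_closed (F i)) -> (forall i, F i `<=` measurable) ->
  ~ Q i0 -> <<s cylinders F Q >> A -> F i0 B ->
  (P (A `&` B) = P A * P B)%E.
Proof.
move=> indF FT FI Fm Qi0 sA FB.
have mB : measurable B by exact: Fm FB.
have PBfin : P B \is a fin_num by exact: fin_num_measure.
pose k : {nonneg R} := NngNum (fine_ge0 (measure_ge0 P B)).
rewrite muleC -[P B]fineK//.
rewrite -[LHS]/(mrestr P mB A) -[RHS]/(mscale k P A).
apply: (g_sigma_algebra_measure_unique (cylinders F Q) _ (fun=> setT)) => //=.
- move=> _ [J [E [EF ->]]].
  by apply: fin_bigcap_measurable => // i /= /EF[_ /Fm].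
- move=> _; exists fset0, (fun=> setT); split => //.
  by rewrite set_fset0 bigcap_set0.
- by rewrite bigcup_const.
- exact: cylinders_setI.
- move=> _ [J [E [EF ->]]].
  have i0J : i0 \notin J by apply/negP => /EF[].
  pose E' i := if i == i0 then B else E i.
  have := indF (i0 |` J)%fset E'.
  have E'E i : i \in J -> E' i = E i.
    by rewrite /E'; case: eqP => // -> iJ; rewrite iJ in i0J.
  rewrite big_fsetU1//= big_seq.
  under eq_bigr do rewrite E'E//.
  rewrite -big_seq (_ : E' i0 = B) ?/E' ?eqxx// -/E'.
  rewrite -(indF _ E); last by move=> i /EF[].
  rewrite /mrestr /mscale/= fineK// => <-.
    congr (P _); apply/seteqP; split => w.
      move=> [w1 w2] i /=; rewrite in_fset1U /E'; case: eqP => //= _ iJ.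
      exact: w1.
    move=> Hw; split; last first.
      by have := Hw i0; rewrite /= in_fset1U eqxx /E' eqxx; apply.
    by move=> i /= iJ; rewrite -E'E//; apply: Hw; rewrite /= in_fset1U iJ orbT.
  by move=> i; rewrite in_fset1U /E'; case: eqP => [->//|_ /= /EF[]].
- move=> _; rewrite /mrestr setTI.
  exact: (le_lt_trans (probability_le1 P mB) (ltry _)).
Qed.

(** The law of the pair is the product of the laws, as the two measures agree on
    rectangles; the iterated integral is then Tonelli's theorem. *)
Lemma independent_freezing {d d1 d2 : measure_display} {T : measurableType d}
    {U : measurableType d1} {V : measurableType d2} {R : realType}
    (P : probability T R) (Z : T -> U) (S : T -> V) (f : U * V -> \bar R) :
  measurable_fun setT Z -> measurable_fun setT S -> measurable_fun setT f ->
  (forall z, 0 <= f z)%E ->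
  (forall A B, measurable A -> measurable B ->
    P (Z @^-1` A `&` S @^-1` B) = P (Z @^-1` A) * P (S @^-1` B))%E ->
  (\int[P]_w f (Z w, S w) = \int[P]_w \int[P]_w' f (Z w, S w'))%E.
Proof.
move=> mZ mS mf f0 ind.
have mZS : measurable_fun setT (fun w => (Z w, S w)).
  exact/measurable_fun_pair.
pose Zm : {mfun T >-> U} := HB.pack Z (isMeasurableFun.Build _ _ _ _ _ mZ).
pose Sm : {mfun T >-> V} := HB.pack S (isMeasurableFun.Build _ _ _ _ _ mS).
pose ZSm : {mfun T >-> _} :=
  HB.pack (fun w => (Z w, S w)) (isMeasurableFun.Build _ _ _ _ _ mZS).
transitivity (\int[distribution P ZSm]_z f z)%E.
  by rewrite ge0_integral_distribution.
transitivity (\int[distribution P Zm \x distribution P Sm]_z f z)%E.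
  apply: eq_measure_integral => X mX _.
  by apply/esym; apply: product_measure_unique => //= A B mA mB; exact: ind.
rewrite fubini_tonelli1// ge0_integral_distribution//=.
- apply: eq_integral => w _; rewrite /= /fubini_F ge0_integral_distribution//.
  exact: measurableT_comp.
- exact: measurable_fun_fubini_tonelli_F.
- by move=> z; apply: integral_ge0.
Qed.

(** * Memorylessness of exponential flights *)

Lemma exponential_ccdf {d : measure_display} {T : measurableType d}
    {R : realType} (P : probability T R) (lambda r : R) (S : {RV P >-> R}) :
  (forall w, 0 < S w) ->
  (forall A : set R, measurable A ->
    distribution P S A = exponential_prob lambda A) ->
  0 <= r -> P [set w | r < S w] = (expR (- lambda * r))%:E.
Proof.
move=> S0 law; rewrite le_eqVlt => /predU1P[<-|r0].
  rewrite mulr0 expR0 -(probability_setT P); congr (P _).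
  by apply/seteqP; split=> // w _; exact: S0.
have -> : [set w | r < S w] = ~` (S @^-1` `[0, r]).
  apply/seteqP; split=> w /=; rewrite in_itv/= (ltW (S0 w))/=.
    by rewrite ltNge => /negP.
  by move/negP; rewrite ltNge.
rewrite probability_setC; last exact: measurable_funPTI.
have -> : P (S @^-1` `[0, r]) = exponential_prob lambda `[0, r].
  by rewrite -law.
by rewrite exponential_prob_itv0c// -!EFinB subKr.
Qed.

(** The tail of min (S, a) is exp (- lambda r) for r < a and 0 beyond, so its
    integral times lambda is the exponential mass of [0, a]. *)
Lemma exponential_expectation_minr {d : measure_display}
    {T : measurableType d} {R : realType} (P : probability T R)
    (lambda a : R) (S : {RV P >-> R}) :
  0 < lambda -> (forall w, 0 < S w) ->
  (forall A : set R, measurable A ->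
    distribution P S A = exponential_prob lambda A) ->
  0 <= a ->
  (\int[P]_w (lambda * Num.min (S w) a)%:E = 1 - (expR (- lambda * a))%:E)%E.
Proof.
move=> lambda0 S0 law; rewrite le_eqVlt => /predU1P[<-|a0].
  rewrite mulr0 expR0 subee//; apply: integral0_eq => w _.
  by rewrite min_r ?mulr0// ltW.
have mX : measurable_fun setT (fun w => Num.min (S w) a).
  exact: measurable_minr.
pose X : {RV P >-> R} :=
  HB.pack (fun w => Num.min (S w) a) (isMeasurableFun.Build _ _ _ _ _ mX).
have X0 w : 0 <= X w by rewrite /X/= le_min !ltW.
under eq_integral do rewrite EFinM.
rewrite ge0_integralZl//; last 3 first.
  exact/measurable_EFinP.
  by move=> w _; rewrite lee_fin; exact: X0.
  by rewrite lee_fin ltW.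
have := ge0_expectation_ccdf X0; rewrite expectation_def /= => ->.
rewrite -exponential_prob_itv0c// /exponential_prob.
have ccdfE (r : R) : 0 <= r -> ccdf X r =
    if r < a then (expR (- lambda * r))%:E else 0%E.
  move=> r0; rewrite /ccdf /distribution /pushforward /=.
  case: ifPn => ra; last first.
    rewrite -leNgt in ra; rewrite (_ : _ @^-1` _ = set0) ?measure0//.
    rewrite -subset0 => w /=; rewrite in_itv/= andbT lt_min => /andP[_].
    by rewrite ltNge ra.
  rewrite -(exponential_ccdf S0 law)//; congr (P _).
  by apply/seteqP; split=> w /=; rewrite in_itv/= andbT lt_min ra andbT.
transitivity (lambda%:E * \int[lebesgue_measure]_(r in `[0%R, a[)
   (expR (- lambda * r))%:E)%E.
  congr (_ * _)%E; rewrite [LHS]integral_mkcond [RHS]integral_mkcond.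
  apply: eq_integral => r _; rewrite !patchE !mem_setE !in_itv/= andbT.
  by have [r0|//] := leP 0 r; rewrite ccdfE//=; case: ifP.
have mexp : measurable_fun [set: R] (fun r => expR (- lambda * r)).
  by apply: measurableT_comp => //; exact: measurable_funM.
rewrite -ge0_integralZl//; last 2 first.
  exact/measurable_EFinP/measurable_funTS.
  by rewrite lee_fin ltW.
rewrite integral_itv_bndo_bndc//; last first.
  by apply/measurable_funTS/emeasurable_funM => //; exact/measurable_EFinP.
apply: eq_integral => r; rewrite inE/= in_itv/= => /andP[r0 _].
by rewrite exponential_pdfE// EFinM.
Qed.

(** In units of the mean flight length 1 / lambda: the length of a flight cut at
    a, plus one mean overshoot when the flight goes beyond a. *)
Definition memoryless_length {R : realType} (lambda a s : R) : R :=
  lambda * Num.min s a + (a < s)%R%:R.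

Section memoryless_length.
Context {d : measure_display} {T : measurableType d} {R : realType}.
Variables (P : probability T R) (lambda a : R) (S : {RV P >-> R}).
Hypotheses (lambda_gt0 : 0 < lambda) (S_gt0 : forall w, 0 < S w).
Hypothesis S_law : forall A : set R, measurable A ->
  distribution P S A = exponential_prob lambda A.
Hypothesis a_ge0 : 0 <= a.

Let measurable_beyond : measurable [set w | a < S w].
Proof.
have -> : [set w | a < S w] = S @^-1` `]a, +oo[.
  by apply/seteqP; split=> w /=; rewrite in_itv/= andbT.
exact: measurable_funPTI.
Qed.

Let beyondE w : ((a < S w)%R%:R : R) = \1_[set w | a < S w] w.
Proof. by rewrite indicE mem_setE. Qed.

Let measurable_minr_a :
  measurable_fun setT (fun w => lambda * Num.min (S w) a).
Proof. by apply: measurable_funM => //; exact: measurable_minr. Qed.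

Let measurable_length :
  measurable_fun setT (fun w => memoryless_length lambda a (S w)).
Proof.
apply: measurable_funD => //.
by under eq_fun do rewrite beyondE; exact: measurable_indic.
Qed.

Let length_ge0 w : 0 <= memoryless_length lambda a (S w).
Proof. by rewrite addr_ge0// mulr_ge0 ?le_min ?a_ge0 ?ltW. Qed.

(** The cut costs exp (- lambda a) mean lengths, which is the probability of the
    overshoot that is added back. *)
Lemma expectation_memoryless_length :
  (\int[P]_w (memoryless_length lambda a (S w))%:E = 1)%E.
Proof.
under eq_integral do rewrite EFinD.
rewrite ge0_integralD//=; last 3 first.
- by move=> w _; rewrite lee_fin mulr_ge0 ?le_min ?a_ge0 ?ltW.
- exact/measurable_EFinP.
- apply/measurable_EFinP.
  by under eq_fun do rewrite beyondE; exact: measurable_indic.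
rewrite exponential_expectation_minr//.
under eq_integral do rewrite beyondE.
by rewrite integral_indic// setIT
     [X in (_ - _ + X)%E](exponential_ccdf S_gt0 S_law a_ge0) subeK.
Qed.

Lemma expectation_affine_memoryless (b k : R) :
  (\int[P]_w (b + k * memoryless_length lambda a (S w))%:E = (b + k)%:E)%E.
Proof.
have ilength :
    P.-integrable setT (EFin \o (fun w => memoryless_length lambda a (S w))).
  apply/integrableP; split; first exact/measurable_EFinP.
  under eq_integral do rewrite /= ger0_norm//.
  by rewrite expectation_memoryless_length ltry.
under eq_integral do rewrite EFinD.
rewrite integralD//=; last 2 first.
- exact: finite_measure_integrable_cst.
- by under eq_fun do rewrite EFinM; exact: integrableZl.
under [X in (_ + X)%E]eq_integral do rewrite EFinM.
rewrite integralZl// expectation_memoryless_length mule1.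
by rewrite integral_cst//= probability_setT mule1.
Qed.

End memoryless_length.

(** * Polygonal paths and their exit from the strip *)

Lemma integrable_disjU {d : measure_display} {T : measurableType d}
    {R : realType} (mu : {measure set T -> \bar R}) (A B : set T)
    (f : T -> \bar R) :
  measurable A -> measurable B -> [disjoint A & B] ->
  mu.-integrable A f -> mu.-integrable B f -> mu.-integrable (A `|` B) f.
Proof.
move=> mA mB AB /integrableP[mfA fA] /integrableP[mfB fB].
have mf : measurable_fun (A `|` B) f by apply/measurable_funU.
apply/integrableP; split => //.
rewrite ge0_integral_setU//; first exact: lte_add_pinfty.
exact: measurableT_comp.
Qed.

Definition arrival {R : realType} (S : nat -> R) (n : nat) : R :=
  \sum_(k < n) S k.

Section renewal_path.
Context {R : realType} (S : nat -> R) (N : R -> nat).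
Hypothesis S_gt0 : forall n, 0 < S n.
Hypothesis N_arrival : forall (t : R) n,
  0 <= t -> (n <= N t)%N = (arrival S n <= t).

Lemma arrivalS n : arrival S n.+1 = arrival S n + S n.
Proof. by rewrite /arrival big_ord_recr. Qed.

Lemma arrival_ge0 n : 0 <= arrival S n.
Proof. by apply: sumr_ge0 => k _; exact: ltW. Qed.

Lemma arrival_le m n : (m <= n)%N -> arrival S m <= arrival S n.
Proof.
move: m n; apply/nondecreasing_seqP => k.
by rewrite arrivalS lerDl ltW.
Qed.

Lemma count_between n t :
  0 <= t -> (N t == n) = (arrival S n <= t < arrival S n.+1).
Proof.
by move=> t0; rewrite ltNge -!N_arrival// -ltnNge ltnS eqn_leq andbC.
Qed.

Lemma count_bounds t : 0 <= t -> arrival S (N t) <= t <= arrival S (N t).+1.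
Proof.
move=> t0; have := eqxx (N t); rewrite (count_between _ t0) => /andP[-> /ltW].
by [].
Qed.

Lemma integral_flight (v : nat -> R) n a t :
  arrival S n <= a -> a <= t -> t <= arrival S n.+1 ->
  lebesgue_measure.-integrable `[a, t[ (EFin \o (fun s => v (N s))) /\
  \int[lebesgue_measure]_(s in `[a, t[) v (N s) = v n * (t - a).
Proof.
move=> na at_ tn.
have vE : {in `[a, t[%classic, cst (v n) =1 (fun s => v (N s))}.
  move=> s; rewrite inE/= in_itv/= => /andP[as_ st]; rewrite /cst; congr v.
  apply/esym/eqP; rewrite count_between ?(le_trans na)//=.
    exact: lt_le_trans tn.
  by rewrite (le_trans (arrival_ge0 n))// (le_trans na).
have mu_fin : (lebesgue_measure `[a, t[ = (t - a)%:E)%E.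
  rewrite lebesgue_measure_itv/= lte_fin; case: ifPn => //.
  rewrite -leNgt => ta; have -> : t = a by apply/le_anti/andP.
  by rewrite subrr.
split.
  apply: (@eq_integrable _ _ _ _ _ _ (EFin \o cst (v n))) => //.
    by move=> s /vE /= ->.
  apply: measurable_bounded_integrable => //.
    by rewrite [X in (X < _)%E]mu_fin ltry.
  exact: bounded_cst.
transitivity (\int[lebesgue_measure]_(s in `[a, t[) v n).
  by apply/esym/eq_Rintegral.
by rewrite Rintegral_cst// [X in fine X]mu_fin.
Qed.

(** Half-open intervals make the flights a partition of the time axis; the right
    end point, where the integrand may already have jumped, is null. *)
Lemma integral_renewal (v : nat -> R) n t :
  arrival S n <= t <= arrival S n.+1 ->
  \int[lebesgue_measure]_(s in `[0, t]) v (N s) =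
  \sum_(k < n) v k * S k + v n * (t - arrival S n).
Proof.
move=> tn; suff [ivN <-] :
    lebesgue_measure.-integrable `[0, t[ (EFin \o (fun s => v (N s))) /\
    \int[lebesgue_measure]_(s in `[0, t[) v (N s) =
    \sum_(k < n) v k * S k + v n * (t - arrival S n).
  by rewrite Rintegral_itv_bndo_bndc.
elim: n t tn => [|n IH] t /andP[nt tn].
  have a0 : arrival S 0 = 0 by rewrite /arrival big_ord0.
  rewrite a0 in nt *; rewrite big_ord0 add0r.
  by apply: integral_flight => //; rewrite a0.
have [|i1 E1] := IH (arrival S n.+1); first by rewrite lexx arrival_le.
have [i2 E2] := integral_flight v (lexx _) nt tn.
have U : `[0, t[%classic = `[0, arrival S n.+1[ `|` `[arrival S n.+1, t[.
  by apply: itv_bndbnd_setU; rewrite bnd_simp// arrival_ge0.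
have dis :
    [disjoint `[0, arrival S n.+1[%classic & `[arrival S n.+1, t[%classic].
  apply/disj_setPS => s [/=]; rewrite !in_itv/= => /andP[_ s1] /andP[s2 _].
  by rewrite ltNge s2 in s1.
split; first by rewrite U; exact: integrable_disjU.
rewrite U Rintegral_setU//; last exact: integrable_disjU.
rewrite E1 E2 big_ord_recr/=; congr (_ + _ + _).
by rewrite arrivalS addrAC subrr add0r.
Qed.

End renewal_path.

Section polygonal_exit.
Context {T : Type} {R : realType} (L : R) (X Y : R -> T -> R) (w : T).
Variables (S v : nat -> R) (N : R -> nat) (y : R).
Hypothesis L_gt0 : 0 < L.
Hypothesis S_gt0 : forall n, 0 < S n.
Hypothesis N_arrival : forall (t : R) n,
  0 <= t -> (n <= N t)%N = (arrival S n <= t).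

Definition vertex n : R := y + \sum_(k < n) v k * S k.

Hypothesis Y_path : forall n t, arrival S n <= t <= arrival S n.+1 ->
  Y t w = vertex n + v n * (t - arrival S n).

Lemma vertexS n : vertex n.+1 = vertex n + v n * S n.
Proof. by rewrite /vertex big_ord_recr/= addrA. Qed.

Let A n := forall k, (k <= n)%N -> 0 <= vertex k <= L.

(** The strip is convex. *)
Lemma flight_inside n t : 0 <= vertex n <= L -> 0 <= vertex n.+1 <= L ->
  arrival S n <= t <= arrival S n.+1 -> 0 <= Y t w <= L.
Proof.
move=> /andP[a0 aL]; rewrite vertexS => /andP[b0 bL] tn; rewrite (Y_path tn).
move: tn; rewrite arrivalS -lerBlDl -[arrival S n <= t]subr_ge0.
move: (t - arrival S n) => s /andP[s0 sS].
have [v0|/ltW v0] := leP 0 (v n).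
  have := ler_wpM2l v0 sS; have := mulr_ge0 v0 s0; lra.
have := ler_wnM2l v0 sS; have := mulr_le0_ge0 v0 s0; lra.
Qed.

(** A flight that ends outside is inside up to some time s after its start and
    outside after s; so s is the infimum of the outside times, although the path
    is still inside, on the boundary, at s. *)
Lemma exit_flight n : A n -> ~ (0 <= vertex n.+1 <= L) ->
  exists2 t : R, exit_time (strip L) X Y w = t%:E &
    Y t w = if vertex n.+1 < 0 then 0 else L.
Proof.
move=> An outn.
have [/andP[a0 aL] Sn] := (An n (leqnn n), S_gt0 n).
set b := if _ then _ else _.
have [s [s0 sS sb]] : exists s, [/\ 0 <= s, s < S n &
    vertex n + v n * s = b /\ forall r, 0 <= r <= S n ->
      (0 <= vertex n + v n * r <= L) = (r <= s)].
  move: outn; rewrite /b vertexS => outn; case: ifPn => [neg|].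
    have v0 : v n < 0.
      rewrite ltNge; apply/negP => v0.
      by have := mulr_ge0 v0 (ltW Sn); lra.
    exists (vertex n / - v n); split.
    - by rewrite divr_ge0// oppr_ge0 ltW.
    - by rewrite ltr_pdivrMr ?oppr_gt0//; lra.
    - split; first by field; rewrite ?oppr_eq0 lt_eqF.
      move=> r /andP[r0 rS]; rewrite ler_pdivlMr ?oppr_gt0//.
      have vr0 : v n * r <= 0 by rewrite mulr_le0_ge0// ltW.
      apply/idP/idP; first by move=> /andP[]; lra.
      by move=> ?; apply/andP; split; lra.
  rewrite -leNgt => pos.
  have {}outn : L < vertex n + v n * S n.
    by rewrite ltNge; apply/negP => ?; apply: outn; rewrite pos.
  have v0 : 0 < v n.
    rewrite ltNge; apply/negP => v0.
    by have := mulr_le0_ge0 v0 (ltW Sn); lra.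
  exists ((L - vertex n) / v n); split.
  - by rewrite divr_ge0 ?subr_ge0// ltW.
  - by rewrite ltr_pdivrMr//; lra.
  - split; first by field; rewrite gt_eqF.
    move=> r /andP[r0 rS]; rewrite ler_pdivlMr//.
    have vr0 : 0 <= v n * r by rewrite mulr_ge0// ltW.
    apply/idP/idP; first by move=> /andP[]; lra.
    by move=> ?; apply/andP; split; lra.
case: sb => sb inside.
have T0 := arrival_ge0 S_gt0 n.
exists (arrival S n + s); last first.
  rewrite (@Y_path n) ?[_ + s]addrC ?addrK//.
  by rewrite arrivalS lerDr s0 addrC lerD2l ltW.
rewrite /exit_time; apply/eqP; rewrite eq_le; apply/andP; split; last first.
  apply: le_ereal_inf_tmp => _ [t [t0 out] <-].
  rewrite lee_fin leNgt; apply/negP => ts; apply: out; rewrite /strip/=.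
  have tN := count_bounds N_arrival (ltW t0).
  have Nn : (N t <= n)%N.
    rewrite leqNgt (N_arrival _ (ltW t0)) arrivalS -ltNge (lt_trans ts)//.
    by rewrite ltrD2l.
  move: Nn; rewrite leq_eqVlt => /predU1P[Nn|Nn].
    rewrite Nn in tN; rewrite (Y_path tN); move: tN; rewrite arrivalS => tN.
    by rewrite inside; lra.
  by apply: flight_inside tN; apply: An => //; exact: ltnW.
(* Outside points exist arbitrarily soon after s, within the same flight. *)
apply/lee_addgt0Pr => eps eps0.
pose r := s + Num.min eps (S n - s).
have r_gt : s < r by rewrite ltrDl lt_min eps0 subr_gt0.
have r_le : r <= S n by rewrite -lerBrDl ge_min lexx orbT.
apply: (@le_trans _ _ (arrival S n + r)%:E).
  apply: ereal_inf_lbound; exists (arrival S n + r) => //; split.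
    by rewrite ltr_wpDl// (le_lt_trans s0).
  rewrite /strip/= (@Y_path n); last first.
    by rewrite arrivalS lerDl lerD2l r_le (le_trans s0)// ltW.
  rewrite [arrival S n + r]addrC addrK inside.
    by apply/negP; rewrite -ltNge.
  by rewrite r_le (le_trans s0)// ltW.
rewrite -EFinD lee_fin -addrA lerD2l lerD2l ge_min lexx//.
Qed.

(** The exit takes place during the flight to the first outside vertex, through
    the side on which that vertex lies; L > 0 keeps the two sides apart. *)
Lemma exit_at_bottom_vertex : 0 <= y <= L ->
  exit_at_bottom L X Y w <-> exists n, A n /\ vertex n.+1 < 0.
Proof.
move=> y0L; split=> [[t tau Yt0]|[n [An neg]]]; last first.
  have [|t tau] := exit_flight An; first by rewrite leNgt neg.
  by rewrite neg => Yt; exists t.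
have [inside|] := pselect (forall n, 0 <= vertex n <= L).
  move: tau; rewrite /exit_time (_ : [set _ | _ in _] = set0) ?ereal_inf0//.
  rewrite -subset0 => z [s [s0 out] sz]; apply: out.
  have sN := count_bounds N_arrival (ltW s0).
  exact: flight_inside sN.
move=> /existsNP[m outm].
have [k /negP outk kmin] := ex_minnP
  (ex_intro (fun m => ~~ (0 <= vertex m <= L)) m (introN idP outm)).
case: k => [|n] in outk kmin.
  by exfalso; apply: outk; rewrite /vertex big_ord0 addr0.
have An : A n.
  by move=> k kn; apply: contraT => /kmin; rewrite leqNgt ltnS kn.
exists n; split => //.
have [t'] := exit_flight An outk.
rewrite tau => -[<-]; rewrite Yt0; case: ifP => // _ L0.
by have := L_gt0; rewrite -L0 ltxx.
Qed.

End polygonal_exit.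

(** * Directions and the embedded chain *)

Section direction.
Context {R : realType}.
Implicit Type j : 'Z_4.

Lemma dirE j : dir R j =
  [:: (1, 0); (0, 1); (- 1, 0); (0, - 1)]`_j.
Proof.
rewrite /dir; case: j => -[|[|[|[|//]]]] /= _.
- by rewrite mulr0 mul0r cos0 sin0.
- by rewrite mulr1 cos_pihalf sin_pihalf.
- by rewrite mulfK ?pnatr_eq0// cospi sinpi.
- have -> : pi * 3 / 2 = pi / 2 + pi :> R by field.
  by rewrite cosDpi sinDpi cos_pihalf sin_pihalf oppr0.
Qed.

(** A quarter turn, clockwise when b holds, is a rotation of the plane. *)
Lemma dir_turn j (b : bool) : dir R (j + (-1) ^+ b) =
  (- (-1) ^+ b * (dir R j).2, (-1) ^+ b * (dir R j).1).
Proof.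
have -> : j + (-1) ^+ b = inZp (j + (if b then 3 else 1)).
  by apply/val_inj; case: b; case: j => -[|[|[|[|//]]]].
rewrite !dirE; case: b; case: j => -[|[|[|[|//]]]] /= _;
  by rewrite ?(expr0, expr1, mulN1r, mul1r, opprK, oppr0).
Qed.

Lemma dir_norm_le1 j : `|(dir R j).1| <= 1.
Proof.
rewrite dirE; case: j => -[|[|[|[|//]]]] /= _;
  by rewrite ?normrN ?normr0 ?normr1 ?ler01.
Qed.

Lemma dir_cases j : [\/ (dir R j).2 = 0, (dir R j).2 = 1 | (dir R j).2 = - 1].
Proof.
rewrite dirE; case: j => -[|[|[|[|//]]]] /= _;
  by [apply: Or31|apply: Or32|apply: Or33].
Qed.

Lemma dir_horizontal j : (dir R j).2 = 0 -> (dir R j).1 != 0.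
Proof.
rewrite dirE; case: j => -[|[|[|[|//]]]] /= _ => [_|/eqP|_|/eqP];
  by rewrite ?oppr_eq0 oner_eq0.
Qed.

End direction.

Section chain.
Context {T : Type} {R : realType} (L c y : R).
Variables (D0 : T -> 'Z_4) (S : nat -> T -> R) (turn : nat -> T -> bool).

Definition heading n w : 'Z_4 := D0 w + \sum_(k < n) (-1) ^+ turn k w.

Definition vspeed n w : R := c * (dir R (heading n w)).2.

Definition height n w : R := vertex (S ^~ w) (vspeed ^~ w) y n.

(** J restricts the initial direction, so that conditioning on it is a choice
    of J. *)
Definition alive (J : set 'Z_4) n : set T :=
  [set w | J (D0 w) /\ forall k, (k <= n)%N -> 0 <= height k w <= L].

Definition falls (J : set 'Z_4) n : set T :=
  alive J n `&` [set w | height n.+1 w < 0].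

Lemma headingS n w : heading n.+1 w = heading n w + (-1) ^+ turn n w.
Proof. by rewrite /heading big_ord_recr/= addrA. Qed.

Lemma heightS n w : height n.+1 w = height n w + vspeed n w * S n w.
Proof. exact: vertexS. Qed.

Lemma vspeedS n w :
  vspeed n.+1 w = c * ((-1) ^+ turn n w * (dir R (heading n w)).1).
Proof. by rewrite /vspeed headingS dir_turn. Qed.

Lemma aliveS J n :
  alive J n.+1 = alive J n `&` [set w | 0 <= height n.+1 w <= L].
Proof.
apply/seteqP; split=> w.
  move=> [Jw H]; split; last exact: H.
  by split => // k kn; apply: H; exact: leqW.
move=> [[Jw H] Hn]; split => // k; rewrite leq_eqVlt => /predU1P[->//|].
by rewrite ltnS; exact: H.
Qed.

Lemma alive_height J n w : alive J n w -> 0 <= height n w <= L.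
Proof. by move=> [_]; exact. Qed.

Lemma vspeed_cases n w :
  [\/ vspeed n w = 0, vspeed n w = c | vspeed n w = - c].
Proof.
rewrite /vspeed; case: (@dir_cases R (heading n w)) => ->.
- by rewrite mulr0; apply: Or31.
- by rewrite mulr1; apply: Or32.
- by rewrite mulrN1; apply: Or33.
Qed.

End chain.

(** The measurable structure on T is arbitrary, so that measurability can be
    used with the sigma-algebra of the past.  The height at the n-th turning
    instant depends on the lengths of n flights but on n - 1 turns only, hence
    the bound k <= n.+1 with turns below n. *)
Section chain_measurable.
Context {d : measure_display} {T : measurableType d} {R : realType}.
Variables (L c y : R).
Variables (D0 : T -> 'Z_4) (S : nat -> T -> R) (turn : nat -> T -> bool).
Variable n : nat.
Hypothesis mD0 : forall A, measurable (D0 @^-1` A).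
Hypothesis mturn : forall k, (k < n)%N -> measurable_fun setT (turn k).

Lemma measurable_heading k A : (k <= n)%N ->
  measurable (heading D0 turn k @^-1` A).
Proof.
elim: k A => [|k IH] A kn.
  rewrite (_ : _ @^-1` A = D0 @^-1` A)//.
  by apply/seteqP; split=> w /=; rewrite /heading big_ord0 addr0.
rewrite (_ : _ @^-1` A = \bigcup_(b in [set: bool])
   (turn k @^-1` [set b] `&`
    heading D0 turn k @^-1` [set j | A (j + (-1) ^+ b)])); last first.
  apply/seteqP; split=> w /=; rewrite headingS; first by exists (turn k w).
  by move=> [b _ /= [->]].
apply: fin_bigcup_measurable => // b _.
apply: measurableI; last exact: IH (ltnW kn).
by rewrite -[X in measurable X]setTI; exact: mturn.
Qed.

Lemma measurable_of_heading (f : 'Z_4 -> R) k : (k <= n)%N ->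
  measurable_fun setT (fun w => f (heading D0 turn k w)).
Proof.
by move=> kn _ B _; rewrite setTI; exact: (measurable_heading (f @^-1` B)).
Qed.

Lemma measurable_vspeed k : (k <= n)%N ->
  measurable_fun setT (vspeed c D0 turn k).
Proof. exact: (@measurable_of_heading (fun j => c * (dir R j).2)). Qed.

Lemma measurable_height k : (k <= n.+1)%N ->
  (forall i, (i < k)%N -> measurable_fun setT (S i)) ->
  measurable_fun setT (height c y D0 S turn k).
Proof.
move=> kn mS; apply: measurable_funD => //; apply: measurable_sum => i.
apply: measurable_funM; last exact: mS.
by apply: measurable_vspeed; rewrite -ltnS (leq_trans _ kn).
Qed.

Lemma measurable_alive J k : (k <= n.+1)%N ->
  (forall i, (i < k)%N -> measurable_fun setT (S i)) ->
  measurable (alive L c y D0 S turn J k).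
Proof.
move=> kn mS.
rewrite (_ : alive _ _ _ _ _ _ _ _ = D0 @^-1` J `&`
    \bigcap_(i in `I_k.+1) (height c y D0 S turn i @^-1` `[0, L])); last first.
  by apply/seteqP; split=> w [Jw H]; split.
apply: measurableI => //; apply: bigcap_measurable; first by exists 0%N.
move=> i; rewrite /= ltnS => ik; rewrite -[X in measurable X]setTI.
apply: measurable_height => //; first exact: leq_trans kn.
by move=> j ji; apply: mS; exact: leq_trans ik.
Qed.

End chain_measurable.

Lemma exit_at_bottom_falls {T : Type} {R : realType} (L c y : R)
    (X Y : R -> T -> R) (D : R -> T -> 'Z_4) (S : nat -> T -> R)
    (N : R -> T -> nat) (turn : nat -> T -> bool) (J : set 'Z_4) :
  0 < L -> 0 <= y <= L -> (forall n w, 0 < S n w) ->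
  (forall (t : R) w n, 0 <= t -> (n <= N t w)%N = (\sum_(k < n) S k w <= t)) ->
  (forall (t : R) w, 0 <= t -> D t w = heading (D 0) turn (N t w) w) ->
  (forall (t : R) w, 0 <= t ->
    Y t w = y + c * \int[lebesgue_measure]_(s in `[0, t]) (dir R (D s w)).2) ->
  exit_at_bottom L X Y `&` [set w | J (D 0 w)] =
  \bigcup_n falls L c y (D 0) S turn J n.
Proof.
move=> L_gt0 y_in S_gt0 N_arrival D_heading Y_integral.
have path w n t : arrival (S ^~ w) n <= t <= arrival (S ^~ w) n.+1 ->
    Y t w = height c y (D 0) S turn n w +
      vspeed c (D 0) turn n w * (t - arrival (S ^~ w) n).
  move=> tn; have t0 : 0 <= t.
    by case/andP: tn => + _; apply: le_trans; apply: arrival_ge0 => k.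
  rewrite Y_integral//.
  pose v k := (dir R (heading (D 0) turn k w)).2.
  transitivity (y + c * \int[lebesgue_measure]_(s in `[0, t]) v (N s w)).
    congr (_ + _ * _); apply: eq_Rintegral => s.
    by rewrite inE/= in_itv/= => /andP[s0 _]; rewrite D_heading.
  rewrite (integral_renewal (S_gt0 ^~ w) _ _ tn); last first.
    by move=> s n' s0; exact: N_arrival.
  rewrite /height /vertex /vspeed -/(v n) mulrDr mulr_sumr addrA mulrA.
  by congr (_ + _ + _); apply: eq_bigr => k _; rewrite mulrA.
have bottom w := exit_at_bottom_vertex X L_gt0 (S_gt0 ^~ w)
  (fun t n t0 => N_arrival t w n t0) (@path w) y_in.
apply/seteqP; split=> w.
  by move=> [/bottom [n [An neg]] Jw]; exists n.
by move=> [n _ [[Jw An] neg]]; split => //; apply/bottom; exists n.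
Qed.

(** * The potential along the chain *)

Section sigma_of.
Context {T U : Type} (G : set_system U) (f : T -> U).

Lemma sigma_of_preimage B : G B -> sigma_of G f (f @^-1` B).
Proof. by move=> GB; exists B => //; rewrite setTI. Qed.

Lemma sigma_ofT : G setT -> sigma_of G f setT.
Proof. by move=> GT; exists setT => //; rewrite setTI preimage_setT. Qed.

Lemma sigma_ofI : setI_closed G -> setI_closed (sigma_of G f).
Proof.
move=> GI _ _ [A GA <-] [B GB <-]; rewrite !setTI -preimage_setI.
exact/sigma_of_preimage/GI.
Qed.

End sigma_of.

Section random_flight.
Context {d : measure_display} {T : measurableType d} {R : realType}.
Variables (P : probability T R) (lambda c L y : R).
Variables (D0 : T -> 'Z_4) (S : nat -> {RV P >-> R}).
Variable turn : nat -> {RV P >-> bool}.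
Hypotheses (lambda_gt0 : 0 < lambda) (c_gt0 : 0 < c) (L_gt0 : 0 < L).
Hypothesis S_gt0 : forall n w, 0 < S n w.
Hypothesis S_law : forall n (A : set R), measurable A ->
  distribution P (S n) A = exponential_prob lambda A.
Hypothesis turn_law :
  forall k, distribution P (turn k) =1 bernoulli_prob 2^-1.
Hypothesis mD0 : forall j, measurable [set w | D0 w = j].
Hypothesis noise_indep : mutually_independent P (noise_sigma D0 S turn).

Local Notation F := (noise_sigma D0 S turn).
Local Notation heading := (heading D0 (fun k => turn k : T -> bool)).
Local Notation vspeed := (vspeed c D0 (fun k => turn k : T -> bool)).
Local Notation height :=
  (height c y D0 (fun k => S k : T -> R) (fun k => turn k : T -> bool)).
Local Notation alive :=
  (alive L c y D0 (fun k => S k : T -> R) (fun k => turn k : T -> bool)).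
Local Notation falls :=
  (falls L c y D0 (fun k => S k : T -> R) (fun k => turn k : T -> bool)).

Lemma measurable_preimage_D0 A : measurable (D0 @^-1` A).
Proof.
rewrite (_ : _ @^-1` A = \bigcup_(j in A) [set w | D0 w = j]).
  by apply: fin_bigcup_measurable => // j _; exact: mD0.
by apply/seteqP; split=> [w Aw|w [j Aj /= ->]//]; exists (D0 w).
Qed.

Lemma noise_sigmaT i : F i setT.
Proof. by case: i => [[k|k]|] /=; apply: sigma_ofT. Qed.

Lemma noise_sigmaI i : setI_closed (F i).
Proof.
by case: i => [[k|k]|] /=; apply: sigma_ofI => //; exact: measurableI.
Qed.

Lemma noise_sigma_measurable i : F i `<=` measurable.
Proof.
case: i => [[k|k]|] A /= [B mB <-]; rewrite setTI.
- exact: measurable_funPTI.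
- exact: measurable_funPTI.
- exact: measurable_preimage_D0.
Qed.

(** Two counters, because flight n is drawn given the past (n, n) and the turn
    that ends it given the past (n + 1, n). *)
Definition past m n : set (option (nat + nat)) :=
  [set i | match i with
           | None => True
           | Some (inl k) => (k < m)%N
           | Some (inr k) => (k < n)%N
           end].

Section past.
Variables m n : nat.
Let G := g_sigma_algebraType (cylinders F (past m n)).

Lemma past_measurable (A : set T) :
  <<s cylinders F (past m n) >> A -> measurable A.
Proof.
apply: smallest_sub; first exact: sigma_algebra_measurable.
move=> _ [J [E [EF ->]]]; apply: fin_bigcap_measurable => // i /= /EF[_].
exact: noise_sigma_measurable.
Qed.

Lemma past_D0 A : measurable (D0 @^-1` A : set G).
Proof.
by apply: (@cylinders_gen _ _ F _ None) => //; exact: sigma_of_preimage.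
Qed.

Lemma past_S k : (k < m)%N -> measurable_fun setT (S k : G -> R).
Proof.
move=> km _ B mB; rewrite setTI.
apply: (@cylinders_gen _ _ F _ (Some (inl k))) => //.
exact: sigma_of_preimage.
Qed.

Lemma past_turn k : (k < n)%N -> measurable_fun setT (turn k : G -> bool).
Proof.
move=> kn _ B mB; rewrite setTI.
apply: (@cylinders_gen _ _ F _ (Some (inr k))) => //.
exact: sigma_of_preimage.
Qed.

(** The cylinder sigma-algebra is coarser than that of T, so the freezing lemma
    applies on T once independence is known. *)
Lemma past_freezing {d1 d2} {U : measurableType d1} {V : measurableType d2}
    (i0 : option (nat + nat)) (Z : T -> U) (X : T -> V) (f : U * V -> \bar R) :
  ~ past m n i0 -> measurable_fun setT (Z : G -> U) ->
  (forall B, measurable B -> F i0 (X @^-1` B)) ->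
  measurable_fun setT f -> (forall z, 0 <= f z)%E ->
  (\int[P]_w f (Z w, X w) = \int[P]_w \int[P]_w' f (Z w, X w'))%E.
Proof.
move=> pi0 mZ FX mf f0.
have sZ A : measurable A -> <<s cylinders F (past m n) >> (Z @^-1` A).
  by move=> mA; have := mZ measurableT _ mA; rewrite setTI.
apply: independent_freezing => //.
- by move=> _ B mB; rewrite setTI; exact: past_measurable (sZ _ mB).
- by move=> _ B mB; rewrite setTI; exact: noise_sigma_measurable (FX _ mB).
- move=> A B mA mB; apply: (mutually_independent_past noise_indep) pi0 _ _.
  + exact: noise_sigmaT.
  + exact: noise_sigmaI.
  + exact: noise_sigma_measurable.
  + exact: sZ.
  + exact: FX.
Qed.

End past.

(** The payoff at the end of a flight to height h: in the strip, the potential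
    averaged over the next turn; below, the potential of a downward flight that
    starts at 0; above, that of an upward flight that starts at L. *)
Definition flight_value (h : R) : R :=
  if 0 <= h <= L then lambda * (L - h) + c
  else if h < 0 then lambda * L + 2 * c else 0.

Lemma flight_value_ge0 (h : R) : 0 <= flight_value h.
Proof.
have [lL c0] := (mulr_gt0 lambda_gt0 L_gt0, c_gt0).
rewrite /flight_value; case: ifPn => [/andP[h0 hL]|_].
  by apply: addr_ge0; [apply: mulr_ge0; rewrite ?subr_ge0//|]; exact: ltW.
by case: ifPn => // _; lra.
Qed.

(** For a vertical flight, with a the time to the boundary ahead, the payoff is
    affine in the memoryless length of the flight cut at a. *)
Lemma expectation_flight_value n (h v : R) : 0 <= h <= L ->
  [\/ v = 0, v = c | v = - c] ->
  (\int[P]_w (flight_value (h + v * S n w))%:E =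
   (lambda * (L - h) + c - v)%:E)%E.
Proof.
move=> /andP[h0 hL] v_cases.
have [l0 c0] := (lambda_gt0, c_gt0).
case: v_cases => ->.
- under eq_integral do rewrite mul0r addr0 /flight_value h0 hL/=.
  by rewrite integral_cst//= probability_setT mule1 subr0.
- have a0 : 0 <= (L - h) / c by rewrite divr_ge0 ?subr_ge0// ltW.
  rewrite -(expectation_affine_memoryless lambda_gt0 (S_gt0 n) (S_law n) a0).
  apply: eq_integral => w _; congr EFin.
  rewrite /flight_value /memoryless_length.
  have S0 := S_gt0 n w; have cS0 := mulr_gt0 c_gt0 S0.
  have [Sa|aS] := leP (S n w) ((L - h) / c).
    rewrite addr0 ifT; first by ring.
    by move: Sa; rewrite ler_pdivlMr// => ?; apply/andP; split; lra.
  move: aS; rewrite ltr_pdivrMr// => aS.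
  rewrite ifF; last by apply/negbTE/negP => /andP[]; lra.
  rewrite ifF; last by apply/negbTE; rewrite -leNgt; lra.
  by rewrite /=; field; rewrite gt_eqF.
- have a0 : 0 <= h / c by rewrite divr_ge0// ltW.
  rewrite -(expectation_affine_memoryless lambda_gt0 (S_gt0 n) (S_law n) a0).
  apply: eq_integral => w _; congr EFin.
  rewrite /flight_value /memoryless_length.
  have S0 := S_gt0 n w; have cS0 := mulr_gt0 c_gt0 S0.
  have [Sa|aS] := leP (S n w) (h / c).
    rewrite addr0 ifT; first by ring.
    by move: Sa; rewrite ler_pdivlMr// => ?; apply/andP; split; lra.
  move: aS; rewrite ltr_pdivrMr// => aS.
  rewrite ifF; last by apply/negbTE/negP => /andP[]; lra.
  rewrite ifT; last by lra.
  by rewrite /=; field; rewrite gt_eqF.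
Qed.

Lemma expectation_turn n (A B : R) :
  (forall b : bool, 0 <= A + B * (-1) ^+ b) ->
  (\int[P]_w (A + B * (-1) ^+ turn n w)%:E = A%:E)%E.
Proof.
move=> AB0.
have p01 : (0 <= (2^-1 : R) <= 1) by lra.
transitivity (\int[distribution P (turn n)]_b (A + B * (-1) ^+ b)%:E)%E.
  by rewrite ge0_integral_distribution.
rewrite (eq_measure_integral (bernoulli_prob 2^-1)); last first.
  by move=> X _ _; exact: turn_law.
rewrite integral_bernoulli_prob//= -!EFinM -EFinD; congr EFin.
by rewrite /unstable.onem expr0 expr1; lra.
Qed.

Lemma measurable_flight_value : measurable_fun setT flight_value.
Proof.
apply: measurable_fun_ifT.
- by apply: measurable_and; exact: measurable_fun_ler.
- apply: measurable_funD => //; apply: measurable_funM => //.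
  exact: measurable_funB.
- by apply: measurable_fun_ifT => //; exact: measurable_fun_ltr.
Qed.

Lemma past_mem m n (A : set T) :
  measurable (A : set (g_sigma_algebraType (cylinders F (past m n)))) ->
  measurable_fun setT
    ((fun w => w \in A) : g_sigma_algebraType (cylinders F (past m n)) -> bool).
Proof.
move=> mA; apply: (measurable_fun_bool true); rewrite setTI.
rewrite (_ : _ @^-1` _ = A)//.
by apply/seteqP; split=> w /=; [exact: set_mem|exact: mem_set].
Qed.

Lemma past_height m n k : (k <= n.+1)%N -> (k <= m)%N ->
  measurable_fun setT
    (height k : g_sigma_algebraType (cylinders F (past m n)) -> R).
Proof.
move=> kn km; apply: (@measurable_height _ _ _ _ _ _ _ _ n) => //.
- exact: past_D0.
- by move=> i; exact: past_turn.
- by move=> i ik; apply: past_S; exact: leq_trans km.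
Qed.

Lemma past_alive J m n k : (k <= n.+1)%N -> (k <= m)%N ->
  measurable (alive J k : set (g_sigma_algebraType (cylinders F (past m n)))).
Proof.
move=> kn km; apply: (@measurable_alive _ _ _ _ _ _ _ _ _ n) => //.
- exact: past_D0.
- by move=> i; exact: past_turn.
- by move=> i ik; apply: past_S; exact: leq_trans km.
Qed.

Lemma past_heading (f : 'Z_4 -> R) m n :
  measurable_fun setT
    ((fun w => f (heading n w)) :
       g_sigma_algebraType (cylinders F (past m n)) -> R).
Proof.
apply: (@measurable_of_heading _ _ _ _ _ n) => //.
- exact: past_D0.
- by move=> i; exact: past_turn.
Qed.

Lemma measurable_height_event n : measurable_fun setT (height n).
Proof.
apply: (@measurable_height _ _ _ _ _ _ _ _ n) => //.
exact: measurable_preimage_D0.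
Qed.

Lemma measurable_alive_event J n : measurable (alive J n).
Proof.
apply: (@measurable_alive _ _ _ _ _ _ _ _ _ n) => //.
exact: measurable_preimage_D0.
Qed.

Lemma measurable_falls J n : measurable (falls J n).
Proof.
apply: measurableI; first exact: measurable_alive_event.
rewrite (_ : [set w | _] = height n.+1 @^-1` `]-oo, 0[).
  by rewrite -[X in measurable X]setTI; exact: measurable_height_event.
by apply/seteqP; split=> w; rewrite /= in_itv.
Qed.

(** With the past frozen, what remains is the expected payoff of flight n. *)
Lemma flight_step J n :
  (\int[P]_(w in alive J n) (lambda * (L - height n w) + c - vspeed n w)%:E =
   \int[P]_(w in alive J n) (flight_value (height n.+1 w))%:E)%E.
Proof.
pose Z w := (w \in alive J n, (height n w, vspeed n w)).
pose f (z : (bool * (R * R)) * R) : \bar R :=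
  if z.1.1 then (flight_value (z.1.2.1 + z.1.2.2 * z.2))%:E else 0%E.
transitivity (\int[P]_w f (Z w, S n w))%E; last first.
  rewrite [RHS]integral_mkcond; apply: eq_integral => w _.
  by rewrite patchE /f/= heightS.
rewrite (@past_freezing n n _ _ _ _ (Some (inl n)))/=.
- rewrite [LHS]integral_mkcond; apply: eq_integral => w _.
  rewrite patchE /f/=; case: ifPn => [wA|_]; last by rewrite integral0.
  have hL := alive_height (set_mem wA).
  apply/esym/expectation_flight_value => //.
  exact: vspeed_cases.
- by rewrite ltnn.
- apply/measurable_fun_pair; first by apply: past_mem; exact: past_alive.
  apply/measurable_fun_pair; first exact: past_height.
  exact: (past_heading (fun j => c * (dir R j).2)).
- by move=> B mB; exact: sigma_of_preimage.
- apply: measurable_fun_ifT => //; first exact: measurableT_comp.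
  apply/measurable_EFinP/(measurableT_comp measurable_flight_value).
  apply: measurable_funD; first by do 2 apply: measurableT_comp => //.
  by apply: measurable_funM => //; do 2 apply: measurableT_comp => //.
- by move=> z; rewrite /f; case: ifP => // _; rewrite lee_fin flight_value_ge0.
Qed.

(** The new vertical speed is the old horizontal one times a fair sign. *)
Lemma turn_step J n :
  (\int[P]_(w in alive J n.+1)
     (lambda * (L - height n.+1 w) + c - vspeed n.+1 w)%:E =
   \int[P]_(w in alive J n.+1) (lambda * (L - height n.+1 w) + c)%:E)%E.
Proof.
pose l j : R := (dir R j).1.
pose Z w := (w \in alive J n.+1, (height n.+1 w, l (heading n w))).
pose g (h s : R) (b : bool) := lambda * (L - h) + c + (- (c * s)) * (-1) ^+ b.
have g_ge0 (h s : R) b : 0 <= h <= L -> `|s| <= 1 -> 0 <= g h s b.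
  move=> /andP[_ hL] s1; have c0 := c_gt0.
  have : 0 <= lambda * (L - h) by rewrite mulr_ge0 ?subr_ge0// ltW.
  have : `|c * s| <= c by rewrite normrM gtr0_norm// ler_piMr// ltW.
  rewrite ler_norml /g => /andP[? ?] ?; case: b; rewrite ?expr1 ?expr0; lra.
(* Tonelli needs a nonnegative integrand everywhere; the truncation is not
   active on values that the chain takes. *)
pose f (z : (bool * (R * R)) * bool) : \bar R :=
  if z.1.1 then (Num.max 0 (g z.1.2.1 z.1.2.2 z.2))%:E else 0%E.
transitivity (\int[P]_w f (Z w, turn n w))%E.
  rewrite [LHS]integral_mkcond; apply: eq_integral => w _.
  rewrite patchE /f/=; case: ifPn => // wA.
  have hL := alive_height (set_mem wA).
  rewrite max_r; last by apply: g_ge0 => //; exact: dir_norm_le1.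
  by rewrite vspeedS /g /l; congr EFin; ring.
rewrite (@past_freezing n.+1 n _ _ _ _ (Some (inr n)))/=.
- rewrite [RHS]integral_mkcond; apply: eq_integral => w _.
  rewrite patchE /f/=; case: ifPn => [wA|_]; last by rewrite integral0.
  have hL := alive_height (set_mem wA).
  have gE b := g_ge0 _ _ b hL (@dir_norm_le1 R (heading n w)).
  under eq_integral do rewrite max_r//.
  by rewrite expectation_turn.
- by rewrite ltnn.
- apply/measurable_fun_pair; first by apply: past_mem; exact: past_alive.
  apply/measurable_fun_pair; first exact: past_height.
  exact: past_heading.
- by move=> B mB; exact: sigma_of_preimage.
- apply: measurable_fun_ifT => //; first exact: measurableT_comp.
  apply/measurable_EFinP; apply: measurable_maxr => //.
  apply: measurable_funD.
    apply: measurable_funD => //; apply: measurable_funM => //.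
    by apply: measurable_funB => //; do 2 apply: measurableT_comp => //.
  apply: measurable_funM.
    apply: measurableT_comp => //; apply: measurable_funM => //.
    by do 2 apply: measurableT_comp => //.
  have msign : measurable_fun setT (fun b : bool => (-1) ^+ b : R) by [].
  exact: (measurableT_comp msign (@measurable_snd _ _ _ _)).
- by move=> z; rewrite /f; case: ifP => // _; rewrite lee_fin le_max lexx.
Qed.

(** A surviving path gets the potential of its new state, a path that falls gets
    the bottom payoff, and one that leaves through the top gets nothing. *)
Lemma potential_step J n :
  (\int[P]_(w in alive J n) (lambda * (L - height n w) + c - vspeed n w)%:E =
   \int[P]_(w in alive J n.+1)
     (lambda * (L - height n.+1 w) + c - vspeed n.+1 w)%:E +
   (lambda * L + 2 * c)%:E * P (falls J n))%E.
Proof.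
have [[l0 c0] L0] := (lambda_gt0, c_gt0, L_gt0).
have lL : 0 < lambda * L by exact: mulr_gt0.
rewrite flight_step turn_step.
rewrite -[X in (_ * P X)%E]setIT -integral_indic//; last first.
  exact: measurable_falls.
rewrite -ge0_integralZl//; last 2 first.
- exact/measurable_EFinP/measurable_indic/measurable_falls.
- by rewrite lee_fin; lra.
rewrite !(integral_mkcond (alive _ _)) -ge0_integralD//.
- apply: eq_integral => w _; rewrite !patchE indicE.
  have -> : (w \in alive J n.+1) =
      (w \in alive J n) && (0 <= height n.+1 w <= L).
    by rewrite aliveS in_setI mem_setE.
  have -> : (w \in falls J n) = (w \in alive J n) && (height n.+1 w < 0).
    by rewrite in_setI mem_setE.
  case: (w \in alive J n) => /=; last by rewrite mule0 adde0.
  rewrite /flight_value; case: ifPn => [/andP[h0 _]|_].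
    by rewrite ltNge h0/= mule0 adde0.
  by case: ifPn => _; rewrite ?mule1 ?mule0 add0e.
- move=> w _; rewrite patchE; case: ifPn => // wA; rewrite lee_fin.
  have /andP[_ hL] := alive_height (set_mem wA).
  by apply: addr_ge0; [apply: mulr_ge0; rewrite ?subr_ge0//|]; exact: ltW.
- apply/(measurable_restrictT _ (measurable_alive_event J n.+1)).
  apply: measurable_funTS; apply/measurable_EFinP.
  apply: measurable_funD => //; apply: measurable_funM => //.
  by apply: measurable_funB => //; exact: measurable_height_event.
- by move=> w _; rewrite mule_ge0// lee_fin; lra.
- apply: emeasurable_funM => //; apply/measurable_EFinP.
  exact/measurable_indic/measurable_falls.
Qed.

Lemma trivIset_falls J : trivIset setT (falls J).
Proof.
apply: ltn_trivIset => m n nm; rewrite -subset0 => w [[_ neg] [[_ in_strip] _]].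
have /andP[h0 _] := in_strip n.+1 nm.
by move: neg; rewrite /= ltNge h0.
Qed.

(** A vertical flight of duration more than L / c crosses the whole strip, and
    its duration is independent of the past. *)
Lemma alive_long_flight J n : (P (alive J n `&` [set w | vspeed n w != 0%R]) *
    (expR (- lambda * (L / c)))%:E + P (alive J n.+1) <= P (alive J n))%E.
Proof.
have [[l0 c0] L0] := (lambda_gt0, c_gt0, L_gt0).
set A := alive J n `&` _.
pose G : set_system T := <<s cylinders F (past n n) >>.
have GA : G A.
  apply: (@measurableI _ (g_sigma_algebraType (cylinders F (past n n)))).
    exact: past_alive.
  rewrite -[X in measurable X]setTI.
  have mv := @past_heading (fun j => c * (dir R j).2) n n.
  have := mv measurableT [set~ 0] (measurableC (measurable_set1 0)).
  congr (measurable (_ `&` _)).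
  by apply/seteqP; split=> w /=; [move=> /eqP|move=> /eqP].
have mA := past_measurable GA.
pose B := [set w | L / c < S n w].
have mB : measurable (S n @^-1` `]L / c, +oo[) by exact: measurable_funPTI.
have BE : B = S n @^-1` `]L / c, +oo[.
  by apply/seteqP; split=> w; rewrite /= in_itv/= andbT.
have a0 : 0 <= L / c by rewrite divr_ge0// ltW.
rewrite -(exponential_ccdf (S_gt0 n) (S_law n) a0) -/B.
have -> : (P A * P B = P (A `&` B))%E.
  apply/esym; apply: (mutually_independent_past noise_indep (Q := past n n)
    (i0 := Some (inl n))) => //.
  - exact: noise_sigmaT.
  - exact: noise_sigmaI.
  - exact: noise_sigma_measurable.
  - by rewrite /= ltnn.
  - by rewrite BE; exact: sigma_of_preimage.
rewrite -measureU//; last 3 first.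
- by rewrite BE; exact: measurableI.
- exact: measurable_alive_event.
- rewrite -subset0 => w [[[aw v0] LS]].
  have /andP[h0 hL] := alive_height aw.
  rewrite aliveS => -[_]; rewrite /= heightS.
  have : L < c * S n w by rewrite mulrC -ltr_pdivrMr.
  move: v0 => /=; case: (vspeed_cases c D0 (fun k => turn k) n w) => ->.
  + by rewrite eqxx.
  + by move=> _ ? /andP[]; lra.
  + by move=> _ ? /andP[]; lra.
apply: le_measure; rewrite ?inE.
- apply: measurableU; last exact: measurable_alive_event.
  by rewrite BE; exact: measurableI.
- exact: measurable_alive_event.
- by move=> w [[[]]//|]; rewrite aliveS => -[].
Qed.

Lemma measurable_vspeed_neq0 n : measurable [set w | vspeed n w != 0%R].
Proof.
rewrite (_ : [set w | _] = heading n @^-1` [set j | c * (dir R j).2 != 0])//.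
apply: (@measurable_heading _ _ _ _ n) => //; exact: measurable_preimage_D0.
Qed.

(** A horizontal flight cannot leave the strip and is followed by a vertical
    one. *)
Lemma alive_vertical J n : (P (alive J n) <=
   P (alive J n `&` [set w | vspeed n w != 0%R]) +
   P (alive J n.+1 `&` [set w | vspeed n.+1 w != 0%R]))%E.
Proof.
have mA k : measurable (alive J k `&` [set w | vspeed k w != 0]).
  apply: measurableI; first exact: measurable_alive_event.
  exact: measurable_vspeed_neq0.
apply: le_trans (measureU2 _ (mA n) (mA n.+1)).
apply: le_measure; rewrite ?inE.
- exact: measurable_alive_event.
- exact: measurableU.
move=> w aw; have [v0|v0] := eqVneq (vspeed n w) 0; last by left.
right; split.
  rewrite aliveS; split => //=; rewrite heightS v0 mul0r addr0.
  exact: alive_height aw.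
rewrite /= vspeedS; apply: mulf_neq0; first by rewrite gt_eqF.
apply: mulf_neq0; rewrite ?signr_eq0//; apply: dir_horizontal.
by move/eqP: v0; rewrite mulf_eq0 gt_eqF//= => /eqP.
Qed.

(** With q the probability that a flight lasts more than L / c, two steps remove
    at least a fraction q of the surviving probability.  The differences of a
    convergent sequence tend to 0, and they dominate q times the sequence. *)
Lemma cvg_alive J : fine (P (alive J n)) @[n --> \oo] --> (0 : R).
Proof.
pose r n := fine (P (alive J n)).
have rE n : P (alive J n) = (r n)%:E.
  by rewrite fineK// fin_num_measure//; exact: measurable_alive_event.
have r_ge0 n : 0 <= r n by exact: fine_ge0.
pose q : R := expR (- lambda * (L / c)).
have q0 : 0 < q by exact: expR_gt0.
have gap n : q * r n <= r n - r n.+2.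
  pose s k := P (alive J k `&` [set w | vspeed k w != 0]).
  have sfin k : s k \is a fin_num.
    rewrite ge0_fin_numE ?measure_ge0// (le_lt_trans _ (ltry 1))//.
    rewrite -(probability_setT P) le_measure ?inE//.
    apply: measurableI; first exact: measurable_alive_event.
    exact: measurable_vspeed_neq0.
  have := alive_vertical J n; have := alive_long_flight J n.+1.
  have := alive_long_flight J n; rewrite -/(s n) -/(s n.+1) !rE.
  rewrite -(fineK (sfin n)) -(fineK (sfin n.+1)) -!EFinM -!EFinD !lee_fin -/q.
  move: (fine (s n)) (fine (s n.+1)) => a b h1 h2 h3.
  have : q * r n <= q * (a + b) by rewrite ler_pM2l.
  lra.
have r_cvg : cvgn r.
  apply: nonincreasing_is_cvgn; last by exists 0 => _ [n _ <-].
  apply/nonincreasing_seqP => n; rewrite -lee_fin -!rE.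
  apply: le_measure; rewrite ?inE; try exact: measurable_alive_event.
  by rewrite aliveS => w [].
have diff0 : (r n - r n.+2) @[n --> \oo] --> (0 : R).
  rewrite -(subrr (limn r)); apply: cvgB => //.
  by rewrite (_ : (fun n => r n.+2) = (fun n => r (n + 2)%N)) ?cvg_shiftn//;
    apply/funext => n; rewrite addn2.
apply: (@squeeze_cvgr _ _ _ _ (cst 0) (fun n => q^-1 * (r n - r n.+2))).
- near=> n; rewrite r_ge0/= -ler_pdivrMl ?invr_gt0// invrK.
  exact: gap.
- exact: cvg_cst.
- by rewrite -(mulr0 q^-1); apply: cvgMl_tmp.
Unshelve. all: by end_near.
Qed.

(** Telescoping [potential_step]; the potential lies between 0 and
    lambda L + 2 c in the strip, so the surviving term vanishes in the limit. *)
Lemma falls_potential J :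
  ((lambda * L + 2 * c)%:E * P (\bigcup_n falls J n) =
   \int[P]_(w in alive J 0) (lambda * (L - height 0 w) + c - vspeed 0 w)%:E)%E.
Proof.
have [[l0 c0] L0] := (lambda_gt0, c_gt0, L_gt0).
have lL : 0 < lambda * L by exact: mulr_gt0.
pose K := lambda * L + 2 * c.
have K0 : 0 < K by rewrite /K; lra.
pose W n := (\int[P]_(w in alive J n)
  (lambda * (L - height n w) + c - vspeed n w)%:E)%E.
have W_bounds n w : alive J n w ->
    0 <= lambda * (L - height n w) + c - vspeed n w <= K.
  move=> aw; have /andP[h0 hL] := alive_height aw.
  have : 0 <= lambda * (L - height n w) by rewrite mulr_ge0 ?subr_ge0// ltW.
  have : 0 <= lambda * height n w by rewrite mulr_ge0// ltW.
  rewrite /K; case: (vspeed_cases c D0 (fun k => turn k) n w) => ->;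
    move=> ? ?; apply/andP; split; lra.
have W_ge0 n : (0 <= W n)%E.
  by apply: integral_ge0 => w /W_bounds /andP[+ _]; rewrite lee_fin.
have W_le n : (W n <= (K * fine (P (alive J n)))%:E)%E.
  rewrite EFinM fineK; last first.
    by rewrite fin_num_measure//; exact: measurable_alive_event.
  rewrite -integral_cst; last exact: measurable_alive_event.
  apply: ge0_le_integral => //.
  - exact: measurable_alive_event.
  - by move=> w /W_bounds /andP[+ _]; rewrite lee_fin.
  - apply: measurable_funTS; apply/measurable_EFinP.
    apply: measurable_funB.
      apply: measurable_funD => //; apply: measurable_funM => //.
      by apply: measurable_funB => //; exact: measurable_height_event.
    apply: (@measurable_vspeed _ _ _ _ _ _ n) => //.
    exact: measurable_preimage_D0.
  - by move=> w /W_bounds /andP[_]; rewrite lee_fin.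
have W_fin n : W n \is a fin_num.
  by rewrite ge0_fin_numE// (le_lt_trans (W_le n))// ltry.
pose p n := fine (P (falls J n)).
have pE n : P (falls J n) = (p n)%:E.
  by rewrite fineK// fin_num_measure//; exact: measurable_falls.
have W_sum n : fine (W 0) = fine (W n) + K * \sum_(0 <= k < n) p k.
  elim: n => [|n ->]; first by rewrite big_geq// mulr0 addr0.
  have := potential_step J n; rewrite -/(W n) -/(W n.+1) pE.
  rewrite -(fineK (W_fin n)) -(fineK (W_fin n.+1)) -EFinM -EFinD => -[->].
  by rewrite big_nat_recr//= -/K; ring.
have Wn0 : fine (W n) @[n --> \oo] --> (0 : R).
  apply: (@squeeze_cvgr _ _ _ _ (cst 0) (fun n => K * fine (P (alive J n)))).
  - near=> n; rewrite fine_ge0//= -lee_fin fineK//.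
  - exact: cvg_cst.
  - by rewrite -(mulr0 K); apply: cvgMl_tmp; exact: cvg_alive.
have sum_cvg : (\sum_(0 <= k < n) p k) @[n --> \oo] --> K^-1 * fine (W 0).
  rewrite (_ : (fun n => _) = (fun n => K^-1 * (fine (W 0) - fine (W n)))).
    rewrite -[X in _ --> K^-1 * X]subr0; apply: cvgMl_tmp; apply: cvgB => //.
    exact: cvg_cst.
  apply/funext => n; rewrite (W_sum n) [fine (W n) + _]addrC addrK mulKf//.
  by rewrite gt_eqF.
have Psum : P (\bigcup_n falls J n) = (K^-1 * fine (W 0))%:E.
  have mU : measurable (\bigcup_n falls J n).
    by apply: bigcup_measurable => n _; exact: measurable_falls.
  have := @measure_semi_sigma_additive _ _ _ P _ (measurable_falls J)
     (@trivIset_falls J) mU.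
  rewrite (_ : (fun n => _) = (fun n => (\sum_(0 <= k < n) p k)%:E)).
    move=> /cvg_lim <- //; apply/cvg_lim => //.
    by apply: cvg_EFin => //; exact: nearW.
  by apply/funext => n; rewrite -sumEFin; apply: eq_bigr => k _; exact: pE.
by rewrite Psum -EFinM mulVKf ?gt_eqF// fineK.
Unshelve. all: by end_near.
Qed.

End random_flight.

(** * Exit probabilities *)

Theorem theorem6 (R : realType) (d : measure_display) (T : measurableType d)
    (P : probability T R) (lambda c L x y : R)
    (X Y : R -> T -> R) (D : R -> T -> 'Z_4)
    (lambda_gt0 : 0 < lambda) (c_gt0 : 0 < c) (L_gt0 : 0 < L)
    (xy_in : strip L (x, y))
    (motion : orthogonal_motion P lambda c x y X Y D) :
  [/\ p_exit_dir P L x y X Y D 1 = lambda * (L - y) / (lambda * L + 2 * c),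
      p_exit_dir P L x y X Y D 3 =
        (2 * c + lambda * (L - y)) / (lambda * L + 2 * c) &
      [/\ p_exit P L x y X Y = (c + lambda * (L - y)) / (lambda * L + 2 * c),
          p_exit_dir P L x y X Y D 0 =
            (c + lambda * (L - y)) / (lambda * L + 2 * c) &
          p_exit_dir P L x y X Y D 2 =
            (c + lambda * (L - y)) / (lambda * L + 2 * c)]].
Proof.
have [S [N [turn [poisson turn_law D0_law indep XYD]]]] := motion.
have [S_gt0 S_law _ N_arrival] := poisson.
have mD0 j := (D0_law j).1.
pose E := exit_at_bottom L X Y.
pose fall J n := falls L c y (D 0) (fun k => S k : T -> R)
  (fun k => turn k : T -> bool) J n.
have K_gt0 : 0 < lambda * L + 2 * c by rewrite addr_gt0 ?mulr_gt0.
have X0 w : X 0 w = x.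
  have [_ -> _] := XYD 0 w (lexx 0).
  by rewrite set_itv1 Rintegral_set1 mulr0 addr0.
have Y0 w : Y 0 w = y.
  have [_ _ ->] := XYD 0 w (lexx 0).
  by rewrite set_itv1 Rintegral_set1 mulr0 addr0.
have EJ J : E `&` [set w | J (D 0 w)] = \bigcup_n fall J n.
  apply: (@exit_at_bottom_falls _ _ _ _ _ X Y D _ N) => //.
  - by move=> t w /(XYD t w)[].
  - by move=> t w /(XYD t w)[].
(* The initial potential is constant on each initial direction. *)
have PE j : P (E `&` [set w | D 0 w = j]) =
    ((lambda * (L - y) + c - c * (dir R j).2) / (4 * (lambda * L + 2 * c)))%:E.
  have start : alive L c y (D 0) (fun k => S k : T -> R)
      (fun k => turn k : T -> bool) [set j] 0 = [set w | D 0 w = j].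
    apply/seteqP; split=> w; first by case.
    move=> Dj; split => // k; rewrite leqn0 => /eqP ->.
    by rewrite /height /vertex big_ord0 addr0.
  have := falls_potential y lambda_gt0 c_gt0 L_gt0 S_gt0 S_law turn_law mD0
    indep [set j].
  rewrite -/(fall _) -(EJ [set j]) start.
  pose phi0 : R := lambda * (L - y) + c - c * (dir R j).2.
  rewrite (eq_integral (cst phi0%:E)); last first.
    move=> w; rewrite inE/= => Dj; rewrite /height /vertex big_ord0 addr0.
    by rewrite /vspeed /heading big_ord0 addr0 Dj.
  rewrite integral_cst// [X in _ = (_ * X)%E](D0_law j).2 => KP.
  have Pfin : P (E `&` [set w | D 0 w = j]) \is a fin_num.
    rewrite fin_num_measure// (EJ [set j]); apply: bigcup_measurable => n _.
    exact: measurable_falls.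
  move: KP; rewrite -(fineK Pfin) -!EFinM => KPE.
  have KP := EFin_inj KPE; congr EFin.
  apply: (mulfI (lt0r_neq0 K_gt0)); rewrite KP /phi0.
  by field; rewrite lt0r_neq0.
have p_dir j : p_exit_dir P L x y X Y D j =
    (lambda * (L - y) + c - c * (dir R j).2) / (lambda * L + 2 * c).
  rewrite /p_exit_dir /cprob.
  rewrite (_ : [set w | [/\ _, _ & _]] = [set w | D 0 w = j]).
    by rewrite PE (D0_law j).2/=; field; rewrite lt0r_neq0.
  by apply/seteqP; split=> w; [case|].
have d0 : (dir R 0).2 = 0 by rewrite dirE.
have d1 : (dir R 1).2 = 1 by rewrite dirE.
have d2 : (dir R 2).2 = 0 by rewrite dirE.
have d3 : (dir R 3).2 = - 1 by rewrite dirE.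
split; rewrite ?p_dir ?d1 ?d3; [by congr (_ / _); ring..|].
split; rewrite ?p_dir ?d0 ?d2; [|by congr (_ / _); ring..].
rewrite /p_exit /cprob (_ : [set w | _ /\ _] = setT); last first.
  by apply/seteqP; split.
rewrite setIT probability_setT/= divr1 -/E.
have -> : E = \big[setU/set0]_(j < 4) (E `&` [set w | D 0 w = j]).
  rewrite -bigcup_seq; apply/seteqP; split=> w; last by case=> j _ [].
  by move=> Ew; exists (D 0 w); rewrite //= mem_index_enum.
rewrite measure_bigsetU_ord.
- rewrite (eq_bigr _ (fun j _ => PE (j : 'Z_4))).
  rewrite sumEFin !big_ord_recl big_ord0 !dirE /=.
  by field; rewrite lt0r_neq0.
- move=> j; rewrite (EJ [set (j : 'Z_4)]).
  apply: bigcup_measurable => n _; exact: measurable_falls.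
- apply/trivIsetP => i j _ _ /eqP ij; rewrite -subset0.
  by move=> w [[_ /= Di] [_ /= Dj]]; apply: ij; rewrite -Di -Dj.
Qed.
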